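(* Let $\mathcal B=\{b_1,b_2,\dots\}\subseteq\mathbb N$ be infinite, and assume that the window $W$ satisfies $\overline{\operatorname{int}(W)}=W$. Then the Toeplitz sequence $\eta=\mathbf 1_{\mathcal F_{\mathcal B}}$ is regular (for the periodic structure $(s_k)_k$, $s_k=\operatorname{lcm}(b_1,\dots,b_k)$) if and only if $m_H(\partial W)=0$.
   Context: $\mathbb N=\{1,2,\dots\}$. For $A\subseteq\mathbb N$ let $\mathcal M_A=\bigcup_{a\in A}a\mathbb Z$, $\mathcal F_A=\mathbb Z\setminus\mathcal M_A$. For a set $\mathcal M$ of integers, $\overline d(\mathcal M)=\limsup_{N\to\infty}\frac1N\operatorname{card}(\mathcal M\cap\{1,\dots,N\})$. $\Delta:\mathbb Z\to\prod_{b\in\mathcal B}\mathbb Z/b\mathbb Z$, $\Delta(n)=(n \bmod b)_{b\in\mathcal B}$; $H:=\overline{\Delta(\mathbb Z)}$ is a compact abelian group (product topology) with normalized Haar measure $m_H$; the window is $W:=\{h\in H: h_b\neq 0\ \forall b\in\mathcal B\}$; interior and boundary $\partial W$ are taken in $H$. A sequence $x\in\{0,1\}^{\mathbb Z}$ is Toeplitz if for every $n\in\mathbb Z$ there is $m\in\mathbb N$ with $x(n+jm)=x(n)$ for all $j\in\mathbb Z$. When $\overline{\operatorname{int}(W)}=W$, the indicator $\eta=\mathbf 1_{\mathcal F_{\mathcal B}}\in\{0,1\}^{\mathbb Z}$ is known to be a Toeplitz sequence. Fix an enumeration $\mathcal B=\{b_1,b_2,\dots\}$ and for $k,i\ge1$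 put $c^{(k)}_{k+i}:=\gcd(\operatorname{lcm}(b_1,\dots,b_k),b_{k+i})$. The Toeplitz sequence $\eta$ is called regular (for the periodic structure $s_k=\operatorname{lcm}(b_1,\dots,b_k)$) if $$\liminf_{k\to\infty}\ \overline d\big(\mathcal M_{\{c^{(k)}_{k+i}:\,i\ge1\}}\setminus\mathcal M_{\{b_1,\dots,b_k\}}\big)=0 .$$ *)

(* Defs.v *)
From HB Require Import structures.
From mathcomp Require Import all_boot all_order all_algebra.
From mathcomp Require Import all_classical all_reals all_analysis.

Set Implicit Arguments.
Unset Strict Implicit.
Unset Printing Implicit Defensive.

Import Order.TTheory GRing.Theory Num.Theory.

Local Open Scope classical_set_scope.
Local Open Scope ring_scope.

(* Z/bZ with the discrete topology.  For b > 0, the only case of interest,    *)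
(* 'I_b.-1.+1 is 'I_b; 'Z_b would be Z/2Z for b = 1.                           *)
Definition residues (b : nat) : Type := 'I_b.-1.+1.

HB.instance Definition _ b := GRing.Zmodule.on (residues b).
HB.instance Definition _ b := isPointed.Build (residues b) 0.
HB.instance Definition _ b :=
  hasNbhs.Build (residues b) principal_filter.
HB.instance Definition _ b := Discrete_ofNbhs.Build (residues b) erefl.

Definition residue (b : nat) (n : int) : residues b :=
  inZp `|(n %% b%:Z)%Z|%N.

Definition residue_prod (B : set nat) : Type :=
  prod_topology (fun b : B => residues (val b)).

Section residue_prod_group.
Variable B : set nat.
Implicit Types x y z : residue_prod B.

HB.instance Definition _ := Topological.on (residue_prod B).

Let add x y : residue_prod B := fun b => x b + y b.
Let opp x : residue_prod B := fun b => - x b.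
Let zero : residue_prod B := fun=> 0.

Let addA : associative add.
Proof.
by move=> x y z; apply: functional_extensionality_dep => b; rewrite /add addrA.
Qed.
Let addC : commutative add.
Proof.
by move=> x y; apply: functional_extensionality_dep => b; rewrite /add addrC.
Qed.
Let add0 : left_id zero add.
Proof.
by move=> x; apply: functional_extensionality_dep => b; rewrite /add add0r.
Qed.
Let addN : left_inverse zero opp add.
Proof.
by move=> x; apply: functional_extensionality_dep => b; rewrite /add addNr.
Qed.

HB.instance Definition _ :=
  GRing.isZmodule.Build (residue_prod B) addA addC add0 addN.

End residue_prod_group.

Lemma residueD b : {morph residue b : m n / m + n}.
Proof.
move=> m n; apply: val_inj; case: b => [|b]; first by rewrite /= !modn1.
have modE (k : int) : `|(k %% b.+1%:Z)%Z|%N%:Z = (k %% b.+1%:Z)%Z.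
  by rewrite gez0_abs ?modz_ge0.
rewrite /= modnDm; apply/eqP; rewrite -eqz_nat -!modz_nat PoszD !modE modzDm.
by rewrite modz_mod.
Qed.

Lemma residueB b : {morph residue b : m n / m - n}.
Proof. by move=> m n; apply: (canRL (addrK _)); rewrite -residueD subrK. Qed.

Section residue_prod_topology.
Variable B : set nat.

Lemma near_coord (x : residue_prod B) (b : B) :
  \forall y \near x, y b = x b.
Proof.
exact: (@proj_continuous B (fun b : B => residues (val b)) b x [set r | r = x b]
  ((principal_filterP _ _).2 erefl)).
Qed.

Lemma cvg_residue_prod (T : Type) (F : set_system T) {FF : Filter F}
    (f : T -> residue_prod B) (x : residue_prod B) :
  (forall b : B, \forall t \near F, f t b = x b) -> f @ F --> x.
Proof.
move=> fx; apply/cvg_sup => b U [_ [[V oV <-] /= Vx sVU]].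
by apply: filterS (fx b) => t e; apply: sVU; rewrite /= e.
Qed.

Let sub_continuous :
  continuous (fun x : residue_prod B * residue_prod B => x.1 - x.2).
Proof.
move=> [x y]; apply: cvg_residue_prod => b.
near=> z.
transitivity (z.1 b - z.2 b); first by [].
congr (_ - _); near: z.
  exact: (@cvg_fst _ _ (nbhs x) (nbhs y) _ _ (near_coord x b)).
exact: (@cvg_snd _ _ (nbhs x) (nbhs y) _ _ (near_coord y b)).
Unshelve. all: by end_near. Qed.

HB.instance Definition _ :=
  PreTopologicalNmodule_isTopologicalZmodule.Build (residue_prod B)
    sub_continuous.

End residue_prod_topology.

Section closure_group.
Variables (G : topologicalZmodType) (A : set G).

Lemma closure_zmod_closed : zmod_closed (mem A) -> zmod_closed (mem (closure A)).
Proof.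
move=> [A0 AB]; split; first by apply/mem_set/subset_closure/set_mem.
have cont_subl (a : G) : continuous (fun y => a - y).
  move=> y; apply: (@continuous_comp _ _ _ (fun y => (a, y)) (fun z => z.1 - z.2)).
    by apply: cvg_pair => /=; [exact: cvg_cst|exact: cvg_id].
  exact: sub_continuous.
have cont_subr (a : G) : continuous (fun x => x - a).
  move=> x; apply: (@continuous_comp _ _ _ (fun x => (x, a)) (fun z => z.1 - z.2)).
    by apply: cvg_pair => /=; [exact: cvg_id|exact: cvg_cst].
  exact: sub_continuous.
have closed_pre (f : G -> G) : continuous f ->
    (forall a, A a -> closure A (f a)) ->
    forall a, closure A a -> closure A (f a).
  move=> cf fA a; rewrite {1}closureEbigcap => /(_ (f @^-1` closure A)); apply; split=> //.
  by apply: preimage_closed; [move=> x _; exact: cf|exact: closed_closure].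
move=> x y /set_mem clx /set_mem cly; apply/mem_set.
apply: (closed_pre (fun x => x - y)) => // {clx}x Ax.
apply: (closed_pre (fun y => x - y)) => // {cly}y Ay.
by apply: subset_closure; apply/set_mem/AB; exact: mem_set.
Qed.

End closure_group.

Definition Delta (B : set nat) (n : int) : residue_prod B :=
  fun b => residue (val b) n.
Arguments Delta : clear implicits.

Lemma range_Delta_zmod_closed (B : set nat) :
  zmod_closed (mem (range (Delta B))).
Proof.
split.
  apply/mem_set; exists 0 => //; apply: functional_extensionality_dep => b.
  by rewrite /Delta -[in LHS](subrr 0) residueB subrr.
move=> x y /set_mem[m _ <-] /set_mem[n _ <-]; apply/mem_set; exists (m - n) => //.
by apply: functional_extensionality_dep => b; exact: residueB.
Qed.

Definition odometer_set (B : set nat) : set (residue_prod B) :=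
  closure (range (Delta B)).
Arguments odometer_set : clear implicits.

(* The group H, with the topology and the addition induced by the product. *)
Definition odometer (B : set nat) : Type := odometer_set B.

HB.instance Definition _ (B : set nat) := Topological.on (odometer B).
HB.instance Definition _ (B : set nat) := SubChoice.on (odometer B).
HB.instance Definition _ (B : set nat) :=
  GRing.SubChoice_isSubZmodule.Build _ _ (odometer B)
    (closure_zmod_closed (@range_Delta_zmod_closed B)).
HB.instance Definition _ (B : set nat) := isPointed.Build (odometer B) 0.

Definition window (B : set nat) : set (odometer B) :=
  [set h | forall b : B, val h b != 0].
Arguments window : clear implicits.

Definition boundary (T : topologicalType) (A : set T) : set T :=
  closure A `\` A°.

Definition borel (T : ptopologicalType) : Type := g_sigma_algebraType (@open T).
HB.instance Definition _ (T : ptopologicalType) := Measurable.on (borel T).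

(* On the compact metrizable group H, the normalized Haar measure is the unique *)
(* translation-invariant Borel probability measure.                             *)
Definition normalized_haar (R : realType) (B : set nat)
    (mu : probability (borel (odometer B)) R) : Prop :=
  forall (g : odometer B) (A : set (borel (odometer B))), measurable A ->
    mu [set g + h | h in A] = mu A.

Definition multiples (A : set nat) : set int :=
  \bigcup_(a in A) [set n : int | (a%:Z %| n)%Z].

Definition free_numbers (A : set nat) : set int := ~` multiples A.

Definition upper_density (R : realType) (M : set int) : \bar R :=
  limn_esup (fun N : nat =>
    (#|[pred i : 'I_N | i.+1%:Z \in M]|%:R / N%:R)%:E).

(* Sequences in {0,1}^Z are maps int -> bool. *)
Definition eta (B : set nat) : int -> bool := fun n => n \in free_numbers B.

Definition toeplitz (x : int -> bool) : Prop :=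
  forall n : int, exists2 m : nat, (0 < m)%N &
    forall j : int, x (n + j * m%:Z) = x n.

(* Enumerations are indexed from 0: b i stands for b_(i+1).  Thus period b k is *)
(* s_k = lcm(b_1, ..., b_k), gcd_set b k is the set of the                      *)
(* c^(k)_(k+i) = gcd(s_k, b_(k+i)) for i >= 1, and b @` `I_k is {b_1, ..., b_k}. *)
Definition period (b : nat -> nat) (k : nat) : nat := \big[lcmn/1%N]_(i < k) b i.

Definition gcd_set (b : nat -> nat) (k : nat) : set nat :=
  range (fun i => gcdn (period b k) (b (k + i)%N)).

Definition regular_toeplitz (R : realType) (b : nat -> nat) : Prop :=
  toeplitz (eta (range b)) /\
  limn_einf (fun k => upper_density R
    (multiples (gcd_set b k) `\` multiples (b @` `I_k))) = 0%E.

(* Main.v *)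
(* Let s_k = lcm(b_1, ..., b_k).  The cylinder of points of H agreeing with   *)
(* Delta(n) in the first k coordinates depends only on n mod s_k, and has     *)
(* Haar measure 1/s_k by invariance.  It is contained in W iff no             *)
(* gcd(s_k, b), b in B, divides n, and one of its first k coordinates         *)
(* vanishes iff some b_i with i <= k divides n.  Hence W minus its interior   *)
(* is the decreasing intersection over k of the union of the cylinders given  *)
(* by n in Q_k = M_{gcd(s_k, b_(k+i)) : i} minus M_{b_1, ..., b_k}, a union   *)
(* whose Haar measure is the density of the s_k-periodic set Q_k.  These      *)
(* densities therefore decrease to the measure of the boundary, which is thus *)
(* the liminf in the definition of regularity.                                *)
(* The sequence eta is Toeplitz because regularity of W puts Delta(n) in the  *)
(* interior of W for every B-free n: gcd(s_k, n) equals some d for all large  *)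
(* k; if Delta(n) were not interior, then for such k every m = n mod s_k is a *)
(* multiple of d, and no cylinder around Delta(m) is contained in W, so that  *)
(* Delta(n) would not be in the closure of the interior.                      *)
Require Import Defs.
From mathcomp Require Import all_boot all_order all_algebra.
From mathcomp Require Import all_classical all_reals all_analysis.
From mathcomp Require Import ring lra.

Set Implicit Arguments.
Unset Strict Implicit.

Import Order.TTheory GRing.Theory Num.Theory.

Local Open Scope classical_set_scope.
Local Open Scope ring_scope.

(** Everything reduces to one identity, [limn_einf_density]: for regular W the liminf of densities
    equals the Haar measure of the boundary, so one vanishes exactly when the other does. It
    combines [bigcap_undecided_cyl] (W minus its interior is a decreasing intersection of unions of
    cylinders) with [haar_undecided_cyl] (the measure of each union is a density). The Toeplitz
    clause is [toeplitz_eta], which rests on [free_interior]. *)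

(** * Residues, congruences and the periods s_k *)

Lemma residue_eq (a : nat) (m n : int) : (0 < a)%N ->
  residue a m = residue a n <-> (a%:Z %| m - n)%Z.
Proof.
case: a => // a _; rewrite -eqz_mod_dvd /residue.
split=> [/(congr1 val)|/eqP -> //].
rewrite /= !modn_small; last 2 first.
- by rewrite -ltz_nat gez0_abs ?modz_ge0 ?ltz_pmod.
- by rewrite -ltz_nat gez0_abs ?modz_ge0 ?ltz_pmod.
by move=> /(congr1 Posz); rewrite !gez0_abs ?modz_ge0 // => /eqP.
Qed.

Lemma residue_eq0 (a : nat) (n : int) : (0 < a)%N ->
  residue a n = 0 <-> (a%:Z %| n)%Z.
Proof.
move=> a0; have <- : residue a 0 = 0 by rewrite -(subrr 0) residueB subrr.
by rewrite residue_eq // subr0.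
Qed.

(** Bezout: if us + vc = gcd(s, c) and n = t gcd(s, c), then tvc = n - tus. *)
Lemma dvdz_gcd_congr (s c : nat) (n : int) : (gcdn s c %| n)%Z ->
  exists2 m : int, (s%:Z %| m - n)%Z & (c%:Z %| m)%Z.
Proof.
move=> /dvdzP[t nE]; have [u [v uv]] := Bezoutz s c.
exists (t * v * c); last exact: dvdz_mull.
rewrite nE -[Posz (gcdn s c)]/(gcdz s c) -uv.
by apply/dvdzP; exists (- t * u); ring.
Qed.

Lemma dvd_period (b : nat -> nat) (k : nat) (n : int) :
  ((period b k)%:Z %| n)%Z <-> forall i, (i < k)%N -> ((b i)%:Z %| n)%Z.
Proof.
rewrite /period /dvdz /=.
rewrite -[X in is_true (X %| _)%N]/(\big[lcmn/1%N]_(i < k | true) b i).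
split => [/dvdn_biglcmP h i ik|h]; first exact: (h (Ordinal ik)).
by apply/dvdn_biglcmP => i _; exact: h.
Qed.

Lemma dvdn_period (b : nat -> nat) (i k : nat) :
  (i < k)%N -> (b i %| period b k)%N.
Proof. exact: (dvd_period b k (period b k)%:Z).1. Qed.

Lemma dvdn_period_leq (b : nat -> nat) (i k : nat) :
  (i <= k)%N -> (period b i %| period b k)%N.
Proof.
move=> ik; apply/(dvd_period b i (period b k)%:Z) => j ji.
by apply: dvdn_period; exact: leq_trans ik.
Qed.

Lemma period_gt0 (b : nat -> nat) (k : nat) : (forall i, (0 < b i)%N) ->
  (0 < period b k)%N.
Proof.
move=> b0; apply: (big_ind (fun x => (0 < x)%N)) => // x y.
by rewrite lcmn_gt0 => -> ->.
Qed.

(** * Density of periodic sets of integers *)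

Definition periodic_set (s : nat) (M : set int) :=
  forall m n : int, (s%:Z %| m - n)%Z -> M n -> M m.

Lemma periodic_setD (s : nat) (M N : set int) :
  periodic_set s M -> periodic_set s N -> periodic_set s (M `\` N).
Proof.
move=> pM pN m n mn [Mn Nn]; split; first exact: pM Mn.
by apply: contra_not Nn; apply: pN; rewrite -opprB rpredN.
Qed.

Lemma periodic_multiples (s : nat) (A : set nat) :
  (forall a, A a -> (a %| s)%N) -> periodic_set s (multiples A).
Proof.
move=> As m n mn [a Aa an]; exists a => //=.
rewrite -(subrK n m) rpredD //; apply: dvdz_trans mn; exact: As.
Qed.

Section density.
Variables (R : realType) (s : nat) (M : set int).
Hypotheses (s0 : (0 < s)%N) (perM : periodic_set s M).

Let count_set (N : nat) := (\sum_(i < N) ((i.+1)%:Z \in M))%N.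

Let count_setE N : #|[pred i : 'I_N | i.+1%:Z \in M]| = count_set N.
Proof. by rewrite -sum1_card big_mkcond. Qed.

Let count_setD m n : count_set (m * s + n) = (m * count_set s + count_set n)%N.
Proof.
have shift k : ((k.+1 + s)%N%:Z \in M) = (k.+1%:Z \in M).
  apply/idP/idP => /set_mem h; apply/mem_set; apply: perM h.
    by rewrite PoszD opprD addNKr rpredN dvdzz.
  by rewrite PoszD addrC addKr dvdzz.
have one n' : count_set (s + n') = (count_set s + count_set n')%N.
  rewrite /count_set big_split_ord /=; congr addn.
  by apply: eq_bigr => i _; rewrite -(shift i) addSn addnC.
elim: m => [|m IH]; first by rewrite !mul0n.
by rewrite !mulSn -!addnA one IH.
Qed.

(** The count up to N differs from N times the mean over one period by at most s, so the frequencies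
    converge with error at most s/N. *)
Lemma periodic_density :
  upper_density R M =
  (#|[pred i : 'I_s | i.+1%:Z \in M]|%:R / s%:R)%:E.
Proof.
rewrite /upper_density.
have le_count N : (count_set N <= N)%N.
  rewrite -[leqRHS]card_ord -sum1_card; apply: leq_sum => i _; exact: leq_b1.
suff : (fun N : nat =>
    (#|[pred i : 'I_N | i.+1%:Z \in M]|%:R / N%:R)%:E) @ \oo -->
    ((count_set s)%:R / s%:R : R)%:E.
  by move=> /cvg_limn_einf_sup [_ ->]; rewrite count_setE.
apply/fine_cvgP; split; first by near=> N.
apply: (cvg_trans (G := (fun N => (count_set N)%:R / N%:R : R) @ \oo)).
  by apply: near_eq_cvg; near=> N; rewrite /= count_setE.
have sR : 0 < s%:R :> R by rewrite ltr0n.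
have bound N : (0 < N)%N ->
    `|(count_set N)%:R / N%:R - (count_set s)%:R / s%:R : R| <= s%:R / N%:R.
  move=> N0; have NR : 0 < N%:R :> R by rewrite ltr0n.
  rewrite (_ : _ - _ = ((count_set N)%:R * s%:R - (count_set s)%:R * N%:R) /
                       (N%:R * s%:R)); last first.
    by field; rewrite !gt_eqF.
  rewrite normrM normfV (gtr0_norm (mulr_gt0 _ _)) //.
  rewrite invfM mulrA mulrAC ler_pM2r ?invr_gt0 // ler_pdivrMr //.
  (* With N = qs + r the full periods cancel; what remains is a difference of two numbers in
     [0, s^2]. *)
  rewrite {1 2}(divn_eq N s) count_setD !natrD !natrM.
  set q := (divn N s)%:R; set e := (count_set (modn N s))%:R.
  have e1 : 0 <= e <= s%:R.
    by rewrite ler0n ler_nat (leq_trans (le_count _)) // ltnW // ltn_mod.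
  have e2 : 0 <= ((modn N s)%:R : R) <= s%:R.
    by rewrite ler0n ler_nat ltnW // ltn_mod.
  have e3 : 0 <= ((count_set s)%:R : R) <= s%:R.
    by rewrite ler0n ler_nat le_count.
  rewrite ler_norml; nra.
apply/cvgrPdist_le => e e0.
near=> N.
rewrite distrC (le_trans (bound _ _)) //; first by near: N; exists 1%N.
rewrite ler_pdivrMr ?ltr0n; last by near: N; exists 1%N.
rewrite mulrC -ler_pdivrMr //; near: N; exact: nbhs_infty_ger.
Unshelve. all: by end_near. Qed.

End density.

(** * Cylinders as a neighbourhood basis of H *)

Section odometer_cylinders.
Variable b : nat -> nat.
Hypothesis b_gt0 : forall i, (0 < b i)%N.

Notation B := (range b).
Notation H := (odometer B).

Definition bcoord (i : nat) : B := SigSub (mem_set (imageT b i)).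

Lemma bcoordP (c : B) : exists i, c = bcoord i.
Proof. by have [i _ bi] := set_mem (valP c); exists i; apply: val_inj. Qed.

Definition cylinder (k : nat) (x : residue_prod B) : set H :=
  [set h | forall i, (i < k)%N -> val h (bcoord i) = x (bcoord i)].

Lemma cylinder_leq (k l : nat) x : (k <= l)%N -> cylinder l x `<=` cylinder k x.
Proof. by move=> kl h hx i ik; apply: hx; exact: leq_trans kl. Qed.

Lemma cylinder_eq (k : nat) (h : H) x :
  cylinder k x h -> cylinder k (val h) = cylinder k x.
Proof. by move=> hx; apply/seteqP; split=> g gh i ik; rewrite gh // hx. Qed.

(** The sets with the required property form a filter [F]; it converges to [x] coordinatewise, hence
    contains every neighbourhood of [x]. *)
Lemma nbhs_residue_prod (x : residue_prod B) (U : set (residue_prod B)) :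
  nbhs x U ->
  exists k, forall y,
    (forall i, (i < k)%N -> y (bcoord i) = x (bcoord i)) -> U y.
Proof.
pose F := [set V : set (residue_prod B) | exists k, forall y,
  (forall i, (i < k)%N -> y (bcoord i) = x (bcoord i)) -> V y].
have FF : Filter F.
  split; first by exists 0%N.
  - move=> P Q [k kP] [l lQ]; exists (maxn k l) => y yx; split.
    + by apply: kP => i ik; apply: yx; rewrite leq_max ik.
    + by apply: lQ => i ik; apply: yx; rewrite leq_max ik orbT.
  - by move=> P Q PQ [k kP]; exists k => y /kP /PQ.
apply: (@cvg_residue_prod B _ F FF id x) => c; have [i ->] := bcoordP c.
by exists i.+1 => y; apply.
Qed.

Lemma nbhs_cylinder (h : H) (U : set H) :
  nbhs h U <-> exists k, cylinder k (val h) `<=` U.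
Proof.
split.
  case=> _ [[V oV <-] /= Vh VU].
  have [k kV] := @nbhs_residue_prod (val h) V (open_nbhs_nbhs (conj oV Vh)).
  by exists k => g hg; apply: VU; exact: kV.
move=> [k kU]; apply: filterS kU _.
elim: k => [|k IHk]; first by apply: filterS filterT => g _ i.
have hk : nbhs h [set g : H | val g (bcoord k) = val h (bcoord k)].
  exact: (@initial_continuous _ _ (set_val : H -> residue_prod B) h _
    (near_coord (val h) (bcoord k))).
apply: filterS2 _ _ IHk hk => g gh ghk i.
by rewrite ltnS leq_eqVlt => /predU1P[->//|]; exact: gh.
Qed.

Lemma open_cylinder (k : nat) x : open (cylinder k x).
Proof.
rewrite openE => h hx; apply/nbhs_cylinder; exists k.
by rewrite (cylinder_eq hx).
Qed.

Lemma Delta_odometer (n : int) : Delta B n \in odometer_set B.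
Proof. by apply/mem_set/subset_closure; exists n. Qed.

Definition Delta_odo (n : int) : H := Sub (Delta B n) (Delta_odometer n).

Lemma val_Delta_odo n : val (Delta_odo n) = Delta B n.
Proof. by []. Qed.

Lemma cylinder_Delta (k : nat) (m n : int) :
  cylinder k (Delta B n) (Delta_odo m) <-> ((period b k)%:Z %| m - n)%Z.
Proof.
rewrite dvd_period; split=> h i ik; apply/(residue_eq _ _ (b_gt0 i));
  exact: (h i ik).
Qed.

Lemma cylinder_Delta_eq (k : nat) (m n : int) :
  ((period b k)%:Z %| m - n)%Z ->
  cylinder k (Delta B m) = cylinder k (Delta B n).
Proof. by move=> /cylinder_Delta /cylinder_eq. Qed.

(** Density of the image of [Delta] in H: to any finite depth, a point of H looks like an
    integer. *)
Lemma cylinder_ex (k : nat) (h : H) : exists n : int, cylinder k (Delta B n) h.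
Proof.
have clh : closure (range (Delta B)) (val h) := set_mem (valP h).
have near_h : \forall y \near (val h : residue_prod B),
    forall i, (i < k)%N -> y (bcoord i) = val h (bcoord i).
  elim: k => [|k IHk]; first by apply: filterS filterT.
  apply: filterS2 _ _ IHk (near_coord (val h) (bcoord k)) => y yh yk i.
  by rewrite ltnS leq_eqVlt => /predU1P[->//|]; exact: yh.
have [_ [[n _ <-] hn]] := clh _ near_h.
by exists n => i /hn ->.
Qed.

Lemma cylinder_setI (k : nat) (m n : int) (h : H) :
  cylinder k (Delta B m) h -> cylinder k (Delta B n) h ->
  ((period b k)%:Z %| m - n)%Z.
Proof.
move=> hm hn; apply/cylinder_Delta.
by rewrite -(cylinder_eq hn) (cylinder_eq hm).
Qed.

(** * The window, its interior and the undecided residue classes *)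

Lemma windowP (h : H) : window B h <-> forall i, val h (bcoord i) != 0.
Proof.
split=> Wh => [i|c]; first exact: Wh.
by have [i ->] := bcoordP c; exact: Wh.
Qed.

Lemma cylinder_eq0 (k i : nat) (n : int) (h : H) : (i < k)%N ->
  cylinder k (Delta B n) h -> (val h (bcoord i) = 0 <-> ((b i)%:Z %| n)%Z).
Proof. by move=> ik /(_ i ik) ->; exact: (residue_eq0 _ (b_gt0 i)). Qed.

(** The cylinder contains a point with i-th coordinate 0 iff n is congruent mod s_k to a multiple of
    b_i, that is, iff gcd(s_k, b_i) divides n. *)
Lemma cylinder_sub_window (k : nat) (n : int) :
  cylinder k (Delta B n) `<=` window B <->
  ~ exists i, (gcdn (period b k) (b i) %| n)%Z.
Proof.
split=> [sW [i /dvdz_gcd_congr[m mn bm]]|ndvd h hn].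
  have /sW/windowP/(_ i)/eqP := (cylinder_Delta k m n).2 mn.
  by apply; apply/(residue_eq0 _ (b_gt0 i)).
apply/windowP => i; apply/eqP => hi0; apply: ndvd; exists i.
(* This depth covers both the first [k] coordinates and coordinate [i]. *)
have [m hm] := cylinder_ex (maxn k i.+1) h.
have bm : ((b i)%:Z %| m)%Z.
  by apply/(cylinder_eq0 _ hm).1 => //; rewrite leq_max leqnn orbT.
have mn : ((period b k)%:Z %| m - n)%Z.
  by apply: cylinder_setI hn; apply: cylinder_leq hm; exact: leq_maxl.
rewrite -(subKr m n) rpredB //.
  by apply: dvdz_trans bm; exact: dvdn_gcdr.
by apply: dvdz_trans mn; exact: dvdn_gcdl.
Qed.

(** Classes mod s_k whose cylinder is not contained in W, although its first [k] coordinates are all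
    nonzero. *)
Definition undecided (k : nat) : set int :=
  multiples (gcd_set b k) `\` multiples (b @` `I_k).

Lemma undecidedP (k : nat) (n : int) :
  undecided k n <-> (exists i, (gcdn (period b k) (b i) %| n)%Z) /\
                (forall i, (i < k)%N -> ~ ((b i)%:Z %| n)%Z).
Proof.
split=> [[[_ [i _ <-] dvd] ndvd]|[[i dvd] ndvd]].
  split; first by exists (k + i)%N.
  by move=> j jk dj; apply: ndvd; exists (b j) => //; exists j.
split; last by move=> [_ [j jk <-]] /=; exact: ndvd.
have [ik|ki] := ltnP i k; last first.
  exists (gcdn (period b k) (b i)) => //.
  by exists (i - k)%N => //; rewrite subnKC.
(* For i < k, b_i divides s_k, so the gcd is b_i itself; allowing all indices [i] therefore adds
   nothing. *)
exfalso; apply: (ndvd i ik); apply: dvdz_trans dvd.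
rewrite dvdzE !absz_nat dvdn_gcd dvdnn andbT.
exact: dvdn_period.
Qed.

Lemma periodic_undecided (k : nat) : periodic_set (period b k) (undecided k).
Proof.
apply: periodic_setD; apply: periodic_multiples => a.
  by move=> [i _ <-]; exact: dvdn_gcdl.
by move=> [i ik <-]; exact: dvdn_period.
Qed.

Definition undecided_cyl (k : nat) : set H :=
  [set h | exists2 n, undecided k n & cylinder k (Delta B n) h].

Lemma undecided_cyl_subset (m n : nat) :
  (m <= n)%N -> undecided_cyl n `<=` undecided_cyl m.
Proof.
move=> mn h [x /undecidedP[[i dvd] ndvd] hx].
exists x; last exact: cylinder_leq hx.
apply/undecidedP; split; last by move=> j jn; apply: ndvd; exact: leq_trans mn.
exists i; apply: dvdz_trans dvd.
rewrite dvdzE !absz_nat dvdn_gcd dvdn_gcdr andbT.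
exact: dvdn_trans (dvdn_gcdl _ _) (dvdn_period_leq _ mn).
Qed.

(** The non-divisibility conditions at all depths say that no coordinate vanishes; the gcd
    conditions say that no cylinder around the point lies in W. *)
Lemma bigcap_undecided_cyl :
  \bigcap_k undecided_cyl k = window B `\` (window B)°.
Proof.
apply/seteqP; split=> h.
  move=> lh; split.
    apply/windowP => i; apply/eqP => hi0.
    have [n /undecidedP[_ ndvd] hn] := lh i.+1 I.
    by apply: (ndvd i (ltnSn i)); apply/(cylinder_eq0 _ hn).1.
  move=> /nbhs_cylinder[k]; have [n /undecidedP[dvd _] hn] := lh k I.
  by rewrite (cylinder_eq hn) => /cylinder_sub_window.
move=> [/windowP Wh Wh'] k _; have [n hn] := cylinder_ex k h.
exists n => //; apply/undecidedP; split.
  apply: contrapT => /cylinder_sub_window sW; apply: Wh'; apply/nbhs_cylinder.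
  by exists k; rewrite (cylinder_eq hn).
by move=> i ik /(cylinder_eq0 ik hn).2 /eqP; apply/negP.
Qed.

(** * The Toeplitz property *)

(** By [cylinder_sub_window], the conclusion says that [Delta B n] is an interior point of W. *)
Lemma free_interior (n : int) : closure (window B)° = window B ->
  free_numbers B n -> exists k, ~ exists i, (gcdn (period b k) (b i) %| n)%Z.
Proof.
move=> W_reg Fn; apply: contrapT => /forallNP noK.
have {noK}dvd k : exists i, (gcdn (period b k) (b i) %| n)%Z by apply: contrapT.
have n0 : n != 0.
  by apply/eqP => n0; apply: Fn; exists (b 0%N);
    [exact: imageT|rewrite n0; exact: dvdz0].
pose g k := gcdn (period b k) `|n|.
have gn k : (g k <= `|n|)%N by rewrite dvdn_leq ?absz_gt0 // dvdn_gcdr.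
(* The numbers [g k] increase under divisibility and are at most |n|, so they are constant from some
   [k0] on. *)
have [k0 gk0] : exists k0, forall k, (g k <= g k0)%N.
  have ex : exists m, `[< exists k, g k = m >].
    by exists (g 0%N); apply/asboolP; exists 0%N.
  have bd m : `[< exists k, g k = m >] -> (m <= `|n|)%N.
    by move=> /asboolP[k <-].
  case: (ex_maxnP ex bd) => m /asboolP[k0 <-] mx; exists k0 => k.
  by apply: mx; apply/asboolP; exists k.
have gE k : (k0 <= k)%N -> g k = g k0.
  move=> k0k; apply/eqP; rewrite eqn_leq gk0 dvdn_leq //.
    by rewrite gcdn_gt0 absz_gt0 n0 orbT.
  rewrite dvdn_gcd dvdn_gcdr andbT.
  exact: dvdn_trans (dvdn_gcdl _ _) (dvdn_period_leq _ k0k).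
have WD : window B (Delta_odo n).
  apply/windowP => i; apply/eqP => /(residue_eq0 _ (b_gt0 i)) bn.
  by apply: Fn; exists (b i) => //; exact: imageT.
move: WD; rewrite -W_reg => /(_ (cylinder k0 (Delta B n))).
case; first by apply/nbhs_cylinder; exists k0; rewrite val_Delta_odo.
move=> h [/nbhs_cylinder[k kW] hn].
(* At depth [l] the cylinder of [m] lies in W, while m is congruent to n mod s_k0. Some gcd(s_l,
   b_i) divides [g l], which equals [g k0] and divides m: a contradiction. *)
pose l := maxn k0 k; have [m hm] := cylinder_ex l h.
have mn : ((period b k0)%:Z %| m - n)%Z.
  by apply: cylinder_setI hn; apply: cylinder_leq hm; exact: leq_maxl.
have : cylinder l (Delta B m) `<=` window B.
  rewrite -(cylinder_eq hm); apply: subset_trans kW.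
  exact/cylinder_leq/leq_maxr.
move=> /cylinder_sub_window; apply.
have [i di] := dvd l; exists i.
have {}di : (gcdn (period b l) (b i) %| g k0)%N.
  by rewrite -(gE l (leq_maxl _ _)) /g dvdn_gcd dvdn_gcdl.
suff : ((g k0)%:Z %| m)%Z by exact: dvdz_trans.
rewrite -(subrK n m) rpredD //; last exact: dvdn_gcdr.
by apply: dvdz_trans mn; exact: dvdn_gcdl.
Qed.

Lemma toeplitz_eta : closure (window B)° = window B -> toeplitz (eta B).
Proof.
move=> W_reg n; rewrite /eta; have [Fn|] := pselect (free_numbers B n).
  have [k nk] := free_interior W_reg Fn.
  exists (period b k); first exact: period_gt0.
  move=> j; rewrite [RHS]mem_set //; apply/mem_set => -[_ [i _ <-] /= bi].
  apply: nk; exists i; rewrite -(addrK (j * (period b k)%:Z) n) rpredB //.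
    by apply: dvdz_trans bi; exact: dvdn_gcdr.
  by apply: dvdz_mull; exact: dvdn_gcdl.
move=> /contrapT [a [i _ <-] /= bn]; exists (b i) => // j.
have free0 x : ((b i)%:Z %| x)%Z -> (x \in free_numbers B) = false.
  move=> bx; apply/negbTE/negP => /set_mem; apply.
  by exists (b i) => //; exact: imageT.
by rewrite !free0 // rpredD // dvdz_mull.
Qed.

(** * Haar measure of cylinders and of the boundary *)

Section haar.
Variables (R : realType) (mu : probability (borel H) R).
Hypothesis haar : normalized_haar mu.

Lemma measurable_open (U : set H) : open U -> measurable (U : set (borel H)).
Proof. exact: sub_sigma_algebra. Qed.

Lemma measurable_cylinder (k : nat) x :
  measurable (cylinder k x : set (borel H)).
Proof. by apply: measurable_open; exact: open_cylinder. Qed.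

(** Translation by [Delta_odo n] carries the cylinder at 0 onto the cylinder at n. *)
Lemma haar_cylinder (k : nat) (n : int) :
  mu (cylinder k (Delta B n)) = mu (cylinder k (Delta B 0)).
Proof.
rewrite -(haar (Delta_odo n) (measurable_cylinder k (Delta B 0))).
congr (mu _); apply/seteqP; split=> [h hn|_ [h h0 <-] i ik].
  exists (h - Delta_odo n); last by rewrite subrKC.
  move=> i ik; rewrite (_ : val _ = val h - Delta B n) //.
  transitivity (val h (bcoord i) - Delta B n (bcoord i)) => //.
  by rewrite hn // /Delta -residueB subrr.
rewrite (_ : val _ = Delta B n + val h) //.
transitivity (Delta B n (bcoord i) + val h (bcoord i)) => //.
by rewrite h0 // /Delta -residueD addr0.
Qed.

Lemma haar_periodic (k : nat) (M : set int) : periodic_set (period b k) M ->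
  mu [set h | exists2 n, M n & cylinder k (Delta B n) h] =
  (#|[pred i : 'I_(period b k) | i.+1%:Z \in M]|%:R%:E *
   mu (cylinder k (Delta B 0)))%E.
Proof.
move=> perM; set s := period b k; have s0 : (0 < s)%N by exact: period_gt0.
pose P := [pred i : 'I_s | i.+1%:Z \in M].
have -> : [set h | exists2 n, M n & cylinder k (Delta B n) h] =
    \big[setU/set0]_(i < s | i \in P) cylinder k (Delta B i.+1).
  rewrite -bigcup_pred; apply/seteqP; split=> h; last first.
    by move=> [i /= /set_mem Mi hi]; exists i.+1.
  (* Reducing n - 1 gives a representative r + 1 in {1, ..., s}, the range counted by
     [upper_density]. *)
  move=> [n Mn hn]; pose r := ((n - 1) %% s)%Z.
  have r0 : (0 <= r)%R by rewrite modz_ge0 // -lt0n.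
  have rs : (`|r| < s)%N by rewrite -ltz_nat gez0_abs // ltz_pmod.
  have rn : (s%:Z %| (`|r|.+1)%:Z - n)%Z.
    rewrite -addn1 PoszD gez0_abs // -eqz_mod_dvd; apply/eqP.
    by rewrite modzDml subrK.
  exists (Ordinal rs) => /=; last by rewrite (cylinder_Delta_eq rn).
  exact/mem_set/perM/Mn.
pose F (i : 'I_s) : set (borel H) := cylinder k (Delta B i.+1).
have mF i : measurable (F i) by exact: measurable_cylinder.
have tF : trivIset setT F.
  apply/trivIsetP => i j _ _; apply: contraNeq => /set0P[h [hi hj]].
  have := cylinder_setI hi hj.
  rewrite -eqz_mod_dvd -(addn1 i) -(addn1 j) !PoszD.
  by rewrite eqz_modDr !modz_small ?ltz_nat ?ltn_ord.
have -> := measure_bigsetU_ord mu P mF tF.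
rewrite (eq_bigr (fun=> mu (cylinder k (Delta B 0)))) => [|i _]; last first.
  exact: haar_cylinder.
by rewrite sumr_const mule_natl.
Qed.

Lemma haar_undecided_cyl (k : nat) :
  mu (undecided_cyl k) = upper_density R (undecided k).
Proof.
have s0 := @period_gt0 b k b_gt0.
rewrite (periodic_density R s0 (@periodic_undecided k)) /undecided_cyl.
rewrite (haar_periodic (@periodic_undecided k)).
have : mu setT = 1%E := probability_setT mu.
(* Applied to all of Z, [haar_periodic] gives s_k times the measure of a cylinder equal to 1, so
   that measure is 1/s_k. *)
have -> : setT = [set h | exists2 n, setT n & cylinder k (Delta B n) h].
  by apply/seteqP; split=> // h _; have [n hn] := cylinder_ex k h; exists n.
rewrite haar_periodic // (eq_card (B := 'I_(period b k))) ?card_ord; last first.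
  by move=> i; rewrite !inE in_setT.
have : mu (cylinder k (Delta B 0)) \is a fin_num.
  by apply: fin_num_measure; exact: measurable_cylinder.
move=> /fineK <-; rewrite -!EFinM => -[e].
have sR : (period b k)%:R != 0 :> R by rewrite pnatr_eq0 -lt0n.
by congr (_ * _)%:E; apply: (mulfI sR); rewrite e mulfV.
Qed.

(** Regularity makes W closed, so its boundary is W minus its interior; continuity of the measure
    from above does the rest. *)
Lemma limn_einf_density :
  closure (window B)° = window B ->
  limn_einf (fun k => upper_density R (undecided k)) = mu (boundary (window B)).
Proof.
move=> W_reg; rewrite /boundary.
have -> : closure (window B) = window B.
  by rewrite -W_reg; apply/esym/closure_id; exact: closed_closure.
rewrite -bigcap_undecided_cyl.
have ml k : measurable (undecided_cyl k : set (borel H)).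
  apply: measurable_open; rewrite openE => h [n ln hn].
  apply/nbhs_cylinder; exists k; rewrite (cylinder_eq hn) => g gn; by exists n.
pose L k : set (borel H) := undecided_cyl k.
have cvgL : (mu \o L) @ \oo --> mu (\bigcap_k L k).
  apply: nonincreasing_cvg_mu.
  - by rewrite ltey_eq fin_num_measure.
  - exact: ml.
  - exact: bigcapT_measurable.
  - by move=> m n nm; apply/subsetPset; exact: undecided_cyl_subset.
have [<- _] := cvg_limn_einf_sup cvgL.
by congr limn_einf; apply/funext => k; rewrite /= haar_undecided_cyl.
Qed.

End haar.
End odometer_cylinders.

Theorem proposition1p2 (R : realType) (B : set nat) (b : nat -> nat)
    (mH : probability (borel (odometer B)) R)
    (Bpos : forall a, B a -> (0 < a)%N)
    (Binf : infinite_set B)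
    (b_enum : set_bij [set: nat] B b)
    (haar_mH : normalized_haar mH)
    (W_reg : closure (window B)° = window B) :
  regular_toeplitz R b <-> mH (boundary (window B)) = 0%E.
Proof.
have BE : B = range b.
  apply/seteqP; split; first exact: set_bij_surj b_enum.
  by move=> _ [i _ <-]; exact: (set_bij_homo b_enum).
(* The type of [mH] depends on [B], so these hypotheses are generalized before [B] is rewritten. *)
move: mH Bpos haar_mH W_reg; rewrite BE => mH Bpos haar_mH W_reg.
have b_gt0 i : (0 < b i)%N by apply: Bpos; exact: imageT.
rewrite /regular_toeplitz -(limn_einf_density b_gt0 haar_mH W_reg).
by split=> [[]|] //; split=> //; exact: toeplitz_eta.
Qed.
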